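(* Let $n\ge 1$, let $\gamma\in\mathbb{R}$ be a parameter, and let $u_1,\dots,u_{2n}$ be real variables. Put $U_1=u_1+u_2+\cdots+u_{2n-1}$ and $U_2=u_2+u_3+\cdots+u_{2n}$, and for $0\le r\le n-1$ let $$I_r=\Psi^{1,2n-2}_{r-1}-U_2\,\Psi^{1,2n-3}_{r-1}-U_1\,\Psi^{2,2n-2}_{r-1}+\Psi^{2,2n-3}_{r-2}+(U_1U_2-\gamma)\,\Psi^{1,2n-2}_r ,$$ where $\Psi$ is evaluated at $c_i=u_i+u_{i+1}$. Then for all $0\le r,s\le n-1$, $$\{I_r,I_s\}_u=0.$$
   Context: The multi-sum $\Psi$ is $$\Psi^{a,b}_r=\left(\ \sum_{\substack{a\le i_1,\ i_r\le b\\ i_j+1<i_{j+1}\ (1\le j<r)}}\ \prod_{j=1}^r \frac{1}{c_{i_j}c_{i_j+1}}\right)\prod_{i=a}^{b+1}c_i ,$$ which after cancellation is a polynomial in $c_a,\dots,c_{b+1}$ (the sum of all products obtained from $c_ac_{a+1}\cdots c_{b+1}$ by deleting $r$ pairwise disjoint pairs of adjacent factors). Conventions: $\Psi^{a,b}_0=\prod_{i=a}^{b+1}c_i$ (empty product equal to 1), $\Psi^{a,b}_r=0$ if $r<0$ or if the index set of the sum is empty with $r\ge1$. Here $c_i=u_i+u_{i+1}$ for $1\le i\le 2n-1$. The Poisson bracket of differentiable functions $g,h$ of $u_1,\dots,u_{2n}$ is $\{g,h\}_u=\nabla_u(g)\,\Omega\,(\nabla_u(h))^T$, where $\nabla_u$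 is the row gradient and $\Omega$ is the constant antisymmetric $2n\times 2n$ matrix with $\Omega_{ij}=(-1)^{j-i+1}$ for $i<j$. *)

(* Defs.v *)
From HB Require Import structures.
From mathcomp Require Import all_boot all_order all_algebra.
From mathcomp Require Import all_classical all_reals all_analysis.

Set Implicit Arguments.
Unset Strict Implicit.
Unset Printing Implicit Defensive.

Import Order.TTheory GRing.Theory Num.Theory.
Import numFieldNormedType.Exports.

Local Open Scope ring_scope.

(* The index set of the multi-sum: a <= i_1, i_r <= b (from the type 'I_b.+1)
   and i_j + 1 < i_{j+1}. *)
Definition adm (a b r : nat) (t : r.-tuple 'I_b.+1) : bool :=
  all (fun i : 'I_b.+1 => (a <= i)%N) t &&
  sorted (fun i j : 'I_b.+1 => (i.+1 < j)%N) t.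

(* c_k is one of the factors c_{i_j}, c_{i_j + 1} cancelled by the tuple t. *)
Definition deleted (b r : nat) (t : r.-tuple 'I_b.+1) (k : nat) : bool :=
  has (fun i : 'I_b.+1 => (k == i) || (k == i.+1)) t.

(* The multi-sum after cancellation, so that it makes sense for every c;
   [Psi_multisum] below relates it to the quotient form.  The rank r is an
   integer, with value 0 for r < 0. *)
Definition Psi (R : comPzRingType) (c : nat -> R) (a b : nat) (r : int) : R :=
  match r with
  | Posz r => \sum_(t : r.-tuple 'I_b.+1 | adm a t)
                \prod_(a <= k < b.+2 | ~~ deleted t k) c k
  | Negz _ => 0
  end.

(* The 1-based coordinate u_i of u = (u_1, ..., u_m), 0 if i is out of range. *)
Definition coord1 (R : pzRingType) (m : nat) (u : 'rV[R]_m) (i : nat) : R :=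
  \sum_(j < m | j.+1 == i) u ord0 j.

Definition cvar (R : pzRingType) (m : nat) (u : 'rV[R]_m) (i : nat) : R :=
  coord1 u i + coord1 u i.+1.

Definition U1 (R : pzRingType) (n : nat) (u : 'rV[R]_(2 * n)) : R :=
  \sum_(1 <= i < 2 * n) coord1 u i.

Definition U2 (R : pzRingType) (n : nat) (u : 'rV[R]_(2 * n)) : R :=
  \sum_(2 <= i < (2 * n).+1) coord1 u i.

(* For n = 1 the truncated bound 2 * n - 3 stands for -1; it only occurs there
   in terms Psi _ _ _ r with r < 0 as soon as r <= n - 1. *)
Definition I_ (R : comPzRingType) (n : nat) (gamma : R) (r : nat)
    (u : 'rV[R]_(2 * n)) : R :=
  let c := cvar u in
  Psi c 1 (2 * n - 2) (r%:Z - 1)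
  - U2 u * Psi c 1 (2 * n - 3) (r%:Z - 1)
  - U1 u * Psi c 2 (2 * n - 2) (r%:Z - 1)
  + Psi c 2 (2 * n - 3) (r%:Z - 2)
  + (U1 u * U2 u - gamma) * Psi c 1 (2 * n - 2) r%:Z.

Definition gradient (R : realType) (m : nat) (g : 'rV[R]_m -> R)
    (u : 'rV[R]_m) : 'rV[R]_m :=
  \row_(i < m) 'D_(delta_mx ord0 i) g u.

Definition Omega (R : pzRingType) (m : nat) : 'M[R]_m :=
  \matrix_(i < m, j < m)
    if (i < j)%N then (-1) ^+ (j - i + 1)
    else if (j < i)%N then - (-1) ^+ (i - j + 1)
    else 0.

Definition poisson (R : realType) (m : nat) (g h : 'rV[R]_m -> R)
    (u : 'rV[R]_m) : R :=
  (gradient g u *m Omega R m *m (gradient h u)^T) ord0 ord0.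

Lemma Psi_multisum (R : fieldType) (c : nat -> R) (a b r : nat) :
  (forall k, (a <= k <= b.+1)%N -> c k != 0) ->
  Psi c a b r%:Z =
  (\sum_(t : r.-tuple 'I_b.+1 | adm a t)
     \prod_(j < r) (1 / (c (tnth t j) * c (tnth t j).+1)))
  * \prod_(a <= k < b.+2) c k.
Proof.
move=> c0; rewrite /= big_distrl /=; apply: eq_bigr => t /andP[at_ st].
rewrite -(big_tuple _ _ t predT (fun i : 'I_b.+1 => 1 / (c i * c i.+1))).
rewrite /deleted; elim: {t}(tval t) at_ st => [|i s IH] /=.
  by rewrite big_nil mul1r => _ _.
move=> /andP[ai at_] st; have {}IH := IH at_ (path_sorted st).
have ib : (i.+1 < b.+2)%N by rewrite ltnS ltn_ord.
have ci : c i != 0 by apply: c0; rewrite ai ltnW.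
have ci1 : c i.+1 != 0 by apply: c0; rewrite leqW.
have gt_s : all (fun j : 'I_b.+1 => (i.+1 < j)%N) s.
  by apply: (order_path_min _ st) => y x z xy; apply: ltn_trans; apply: ltnW.
have nd k : (k <= i.+1)%N ->
    ~~ has (fun j : 'I_b.+1 => (k == j) || (k == j.+1)) s.
  move=> ki; apply/hasPn => j /(allP gt_s) ij.
  by rewrite !ltn_eqF // (leq_ltn_trans ki) // ltnW.
have D1 (P : pred nat) j : (a <= j < b.+2)%N -> P j ->
    \prod_(a <= k < b.+2 | P k) c k =
    c j * \prod_(a <= k < b.+2 | P k && (k != j)) c k.
  move=> jab Pj; rewrite -big_filter (bigD1_seq j) /=.
  - by rewrite big_filter_cond.
  - by rewrite mem_filter Pj mem_index_iota.
  - by rewrite filter_uniq // iota_uniq.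
rewrite big_cons -mulrA -IH [in RHS](D1 _ i.+1); last 2 first.
- by rewrite ib leqW.
- exact: nd.
rewrite [in RHS](D1 _ i); last 2 first.
- by rewrite ai ltnW.
- by rewrite nd ?leqnSn //= ltn_eqF.
have simpl_div x y z : x != 0 -> y != 0 -> 1 / (x * y) * (y * (x * z)) = z :> R.
  by move=> x0 y0; rewrite div1r [y * _]mulrCA [x * (y * z)]mulrA mulKf ?mulf_neq0.
rewrite simpl_div //; apply: eq_bigl => k; rewrite !negb_or.
by case: (k == i); case: (k == i.+1); rewrite ?andbT ?andbF.
Qed.

(* Main.v *)
Require Import Defs.
From HB Require Import structures.
From mathcomp Require Import all_boot all_order all_algebra.
From mathcomp Require Import all_classical all_reals all_analysis.
From mathcomp Require Import ring zify.
Import Order.TTheory GRing.Theory Num.Theory.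
Import numFieldNormedType.Exports.
Local Open Scope ring_scope.

Set Implicit Arguments.
Unset Strict Implicit.
Unset Printing Implicit Defensive.

(* The 2n+1 linear forms c_1, ..., c_{2n-1}, -U_1, -U_2, written x_0, ..., x_{2n},
   satisfy {x_k, x_{k+1}} = 1 cyclically, all other brackets being 0.  The I_r are
   the coefficients in lambda of I = tr (L_0 ... L_{2n}), where
   L_k = [[x_k, z_k], [1, 0]], with z_k = lambda except z_{2n-1} = lambda - gamma
   (the dressing chain).  With f_k = dI/dx_k and T_k = L_k ... L_{k+2n}, the
   relation L_k T_{k+1} = T_k L_k gives, for e_k the lower right entry of T_{k+1},
     e_{k+1} + e_k + x_{k+1} f_{k+1} = I,
     z_{k+1} f_{k+2} - z_k f_k = x_{k+1} (e_{k+1} - e_k).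
   Multiply the second relation for lambda by the f_{k+1} of mu and conversely, add,
   and eliminate x with the first one: (lambda - mu) (f_k f'_{k+1} - f_{k+1} f'_k)
   becomes a difference of consecutive terms of a periodic sequence, hence
   {I(lambda), I(mu)} = sum_k (f_k f'_{k+1} - f_{k+1} f'_k) = 0. *)

(** * A telescoping identity for periodic sequences *)

Section CyclicInvolution.
Variables (A : idomainType) (m : nat).

(** Primed letters are the same quantities at a second spectral parameter, [x] being common to both.
    The difference [d] of the parameters can be cancelled in an integral domain. *)
Lemma cyclic_involution (x z z' f f' e e' : nat -> A) (t t' d : A) :
  d != 0 -> (forall k, z k - z' k = d) ->
  z m = z 0 -> z' m = z' 0 -> e m = e 0 -> e' m = e' 0 ->
  (forall k, f (k + m)%N = f k) -> (forall k, f' (k + m)%N = f' k) ->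
  (forall k, z k.+1 * f k.+2 - z k * f k = x k.+1 * (e k.+1 - e k)) ->
  (forall k, z' k.+1 * f' k.+2 - z' k * f' k = x k.+1 * (e' k.+1 - e' k)) ->
  (forall k, e k.+1 + e k + x k.+1 * f k.+1 = t) ->
  (forall k, e' k.+1 + e' k + x k.+1 * f' k.+1 = t') ->
  \sum_(0 <= k < m) (f k * f' k.+1 - f k.+1 * f' k) = 0.
Proof.
move=> d0 zd zm z'm em e'm fm f'm R1 R1' R2 R2'.
(* The terms in [e] and [e'] arise when [R2] and [R2'] eliminate [x] from the right sides of [R1]
   and [R1'], multiplied crosswise by [f'] and [f]; the terms in [z] are the left sides, and the
   last one comes from z' = z - d. *)
pose H k := t' * e k + t * e' k - e k * e' k *+ 2
  - z k * (f k.+1 * f' k + f k * f' k.+1) + d * (f k * f' k.+1).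
apply: (mulfI d0); rewrite mulr0 mulr_sumr.
under eq_bigr => k _.
  have -> : d * (f k * f' k.+1 - f k.+1 * f' k) = - (H k.+1 - H k).
    have z'E j : z' j = z j - d by rewrite -(zd j); ring.
    have := congr1 ( *%R (f' k.+1)) (R1 k).
    have := congr1 ( *%R (f k.+1)) (R1' k).
    rewrite /H -(R2 k) -(R2' k) !z'E => h h'.
    apply/eqP; rewrite -subr_eq0; apply/eqP.
    move/eqP: h; rewrite -subr_eq0 => /eqP h.
    move/eqP: h'; rewrite -subr_eq0 => /eqP h'.
    (* The difference of the two sides is minus the sum of the relations [h] and [h']. *)
    rewrite -[RHS]addr0 -[X in _ = X + _]oppr0 -{1}h -[X in _ = _ + X]oppr0 -h'; ring.
  over.
rewrite sumrN telescope_sumr // /H zm em e'm.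
by rewrite (fm 0) (fm 1) (f'm 0) (f'm 1) subrr oppr0.
Qed.

End CyclicInvolution.

(** * Lax matrices and their periodic products *)

Definition Lax (A : pzRingType) (x z : A) : 'M[A]_2 :=
  \matrix_(i, j) if i == ord0 then (if j == ord0 then x else z)
                 else (j == ord0)%:R.

Lemma sum_ord2 (V : nmodType) (F : 'I_2 -> V) :
  \sum_i F i = F ord0 + F ord_max.
Proof. by rewrite big_ord_recl big_ord1; congr (_ + F _); apply: val_inj. Qed.

Lemma mulmx2E (A : pzSemiRingType) (M N : 'M[A]_2) i j :
  (M * N) i j = M i ord0 * N ord0 j + M i ord_max * N ord_max j.
Proof. by rewrite -mulmxE mxE sum_ord2. Qed.

Lemma mxtrace2E (A : pzSemiRingType) (M : 'M[A]_2) :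
  \tr M = M ord0 ord0 + M ord_max ord_max.
Proof. exact: sum_ord2. Qed.

Section Monodromy.
Variables (A : comNzRingType) (m : nat) (x z : nat -> A).
Hypotheses (x_per : forall k, x (k + m.+1)%N = x k).
Hypotheses (z_per : forall k, z (k + m.+1)%N = z k).

Let L k := Lax (x k) (z k).
Let T i := \prod_(i <= k < i + m.+1) L k.

(** The monodromy without its factor [L i]: multiplying by [L i] on the left restores [T i], and on
    the right, by periodicity, [T i.+1]. *)
Definition mono_cofactor i : 'M[A]_2 := \prod_(i.+1 <= k < i + m.+1) L k.
(* The derivative of \tr (T 0) with respect to x i. *)
Definition mono_grad i : A := mono_cofactor i ord0 ord0.
Definition mono_edge i : A := T i.+1 ord_max ord_max.

Lemma prod_Lax_shift i j :
  \prod_(i + m.+1 <= k < j + m.+1) L k = \prod_(i <= k < j) L k.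
Proof.
rewrite big_addn addnK; apply: eq_bigr => k _.
by rewrite /L x_per z_per.
Qed.

Lemma mono_recl i : T i = L i * mono_cofactor i.
Proof. by rewrite /T big_ltn // -[X in (X < _)%N]addn0 ltn_add2l. Qed.

Lemma mono_recr i : T i.+1 = mono_cofactor i * L i.
Proof.
rewrite /T /mono_cofactor addSn big_nat_recr ?addnS ?leq_addr //=.
by rewrite -addnS /L x_per z_per.
Qed.

(** Each step moves the factor [L i] from the left end of the product to the right end. *)
Lemma mono_trace i : \tr (T i) = \tr (T 0%N).
Proof.
elim: i => // i <-; rewrite (mono_recl i) mono_recr -!mulmxE; exact: mxtrace_mulC.
Qed.

Lemma mono_cofactor_per i : mono_cofactor (i + m.+1) = mono_cofactor i.
Proof. by rewrite /mono_cofactor -addSn prod_Lax_shift. Qed.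

Lemma mono_grad_per i : mono_grad (i + m.+1) = mono_grad i.
Proof. by rewrite /mono_grad mono_cofactor_per. Qed.

Lemma mono_edge_per i : mono_edge (i + m.+1) = mono_edge i.
Proof. by rewrite /mono_edge /T -addSn prod_Lax_shift. Qed.

Let T_cofactor i :
  [/\ T i.+1 ord0 ord0 = mono_grad i * x i + mono_cofactor i ord0 ord_max,
      T i.+1 ord0 ord_max = mono_grad i * z i
    & T i.+1 ord_max ord0 = mono_grad i.+1 ].
Proof.
split.
- by rewrite mono_recr mulmx2E !mxE /= mulr1.
- by rewrite mono_recr mulmx2E !mxE /= mulr0 addr0.
- by rewrite mono_recl mulmx2E !mxE /= mul1r mul0r addr0.
Qed.

Let T_conj i : T i * L i = L i * T i.+1.
Proof. by rewrite (mono_recl i) mono_recr mulrA. Qed.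

(** The lower left entry of [T_conj k.+1] expresses the upper left entry of [T k.+2]; adding
    [mono_edge k.+1] completes the trace. *)
Lemma mono_expand k :
  mono_edge k.+1 + mono_edge k + x k.+1 * mono_grad k.+1 = \tr (T 0%N).
Proof.
rewrite -(mono_trace k.+2) mxtrace2E /mono_edge.
have := congr1 (fun M : 'M[A]_2 => M ord_max ord0) (T_conj k.+1).
rewrite !mulmx2E !mxE /= mulr1 mul1r mul0r addr0 => <-.
by case: (T_cofactor k) => _ _ ->; ring.
Qed.

(** This is the upper left entry of [T_conj k.+1], with the upper left entries of [T k.+1] and
    [T k.+2] written as the trace minus an edge. *)
Lemma mono_neighbours k :
  z k.+1 * mono_grad k.+2 - z k * mono_grad k =
  x k.+1 * (mono_edge k.+1 - mono_edge k).
Proof.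
have := congr1 (fun M : 'M[A]_2 => M ord0 ord0) (T_conj k.+1).
have := mono_trace k.+1; have := mono_trace k.+2.
rewrite !mxtrace2E !mulmx2E !mxE /= -/(mono_edge k) -/(mono_edge k.+1).
case: (T_cofactor k) => _ -> _; case: (T_cofactor k.+1) => _ _ ->.
set t := _ + T 0%N _ _ => /(canRL (addrK _)) -> /(canRL (addrK _)) -> h.
by apply: (addrI (x k.+1 * (t - mono_edge k.+1))); rewrite addrA -h; ring.
Qed.

End Monodromy.

(** * Continuants *)

(** The gap relation is transitive, so all later indices exceed [i.+1], a bound that absorbs the one
    by [a]. *)
Lemma adm_cons (a b r : nat) (i : 'I_b.+1) (t : r.-tuple 'I_b.+1) :
  adm a [tuple of i :: t] = (a <= i)%N && adm i.+2 t.
Proof.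
have tr : transitive (fun i j : 'I_b.+1 => (i.+1 < j)%N).
  by move=> y x z /= xy yz; lia.
rewrite /adm /= (path_sortedE tr); case: leqP => //= ai.
case: (sorted _ t); rewrite ?andbF // !andbT.
by rewrite -all_predI; apply: eq_all => j /=; lia.
Qed.

Arguments Psi : simpl never.

Section Continuant.
Variables (R : comNzRingType) (c : nat -> R).

Lemma Psi0 (a b : nat) : Psi c a b 0%N%:Z = \prod_(a <= k < b.+2) c k.
Proof.
rewrite /Psi (big_pred1 [tuple]) => [|t].
  by apply: eq_big => // k.
by rewrite [t]tuple0 /adm /= eqxx.
Qed.

Lemma Psi_gt (a b r : nat) : (b < a)%N -> Psi c a b r.+1%:Z = 0.
Proof.
move=> ba; rewrite /Psi big1 // => t; case/tupleP: t => i t.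
by rewrite adm_cons => /andP[ai _]; have := ltn_ord i; lia.
Qed.

(** Euler's continuant recursion: either [c a] survives, or the pair [c a], [c a.+1] is deleted by a
    tuple starting at [a]. *)
Lemma PsiS (a b r : nat) : (a <= b)%N ->
  Psi c a b r.+1%:Z = c a * Psi c a.+1 b r.+1%:Z + Psi c a.+2 b r%:Z.
Proof.
move=> ab; rewrite /Psi.
rewrite (bigID (fun t : r.+1.-tuple 'I_b.+1 => thead t == a :> nat)) /= addrC.
have ab1 : (a < b.+1)%N by [].
congr (_ + _).
  rewrite big_distrr /=; apply: eq_big => [t|t].
    case/tupleP: t => i t; rewrite theadE !adm_cons.
    by rewrite ltn_neqAle eq_sym; case: eqP; rewrite ?andbF ?andbT.
  case/tupleP: t => i t; rewrite theadE adm_cons => /andP[/andP[ai ti] ia].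
  have lt_ai : (a < i)%N by rewrite ltn_neqAle eq_sym ia.
  rewrite big_ltn_cond ?ifT //; last exact: ltnW.
  rewrite /deleted -all_predC; apply/allP => j; rewrite inE => /orP[/eqP->|jt].
    by rewrite /=; lia.
  by case/andP: ti => /allP/(_ _ jt) /=; lia.
rewrite (reindex_onto (fun t : r.-tuple 'I_b.+1 => [tuple of Ordinal ab1 :: t])
  (fun t => [tuple of behead t])) /=; last first.
  move=> t /andP[_]; case/tupleP: t => i t; rewrite theadE => /eqP ia.
  by apply: val_inj; congr (_ :: _); apply: val_inj.
apply: eq_big => [t|t].
  rewrite adm_cons leqnn eqxx !andbT /=.
  by case: eqP => [_|[]]; [rewrite andbT|apply: val_inj].
rewrite adm_cons => /andP[/andP[/andP[_ ti] _] _].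
rewrite big_ltn_cond /=; last lia.
rewrite big_ltn_cond /=; last lia.
rewrite !ifF; last by rewrite /deleted /= eqxx.
  rewrite big_nat_cond [RHS]big_nat_cond; apply: eq_bigl => k.
  case: (boolP (_ <= _ < _)%N) => //= /andP[k1 _].
  by rewrite /deleted /= gtn_eqF 1?ltnW //= gtn_eqF.
by rewrite /deleted /= eqxx orbT.
Qed.

(** The upper left entry is the continuant of the [c k] with a <= k < b, each deleted adjacent pair
    being marked by a factor ['X]. *)
Definition chain (a b : nat) : 'M[{poly R}]_2 :=
  \prod_(a <= k < b) Lax (c k)%:P 'X.

Lemma chain_top (a b : nat) : (a.+1 < b)%N ->
  chain a b ord0 ord0 =
  (c a)%:P * chain a.+1 b ord0 ord0 + 'X * chain a.+2 b ord0 ord0.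
Proof.
move=> ab; rewrite /chain big_ltn 1?ltnW // mulmx2E !mxE /=; congr (_ + _ * _).
by rewrite big_ltn // mulmx2E !mxE /= mul1r mul0r addr0.
Qed.

(** Both sides obey the same two-step recursion, hence the induction on a bound [d] for the number
    of factors; ranges with no factor or a single one are the base cases. *)
Lemma Psi_coef (a b r : nat) : (a <= b.+2)%N ->
  Psi c a b r%:Z = (chain a b.+2 ord0 ord0)`_r.
Proof.
move: {2}(b.+2 - a)%N (leqnn (b.+2 - a)) => d.
elim: d a r => [|d IHd] a r dle ab.
  have -> : a = b.+2 by lia.
  rewrite /chain big_geq // mxE /= coefC; case: r => [|r].
    by rewrite Psi0 big_geq.
  by rewrite Psi_gt.
have [->|ab2] := eqVneq a b.+2; first by apply: IHd; lia.
have [->|ab1] := eqVneq a b.+1.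
  rewrite /chain big_nat1 mxE /= coefC; case: r => [|r].
    by rewrite Psi0 big_nat1.
  by rewrite Psi_gt.
rewrite chain_top ?coefD ?coefCM ?coefXM; last lia.
case: r => [|r] /=; last by rewrite PsiS -?IHd //; lia.
by rewrite addr0 -IHd; [|lia..]; rewrite !Psi0 big_ltn; last lia.
Qed.

(** Lowering the rank is multiplication by a power of ['X]; a negative rank meets a vanishing low
    coefficient. *)
Lemma Psi_coefB (a b r k : nat) : (a <= b.+2)%N ->
  Psi c a b (r%:Z - k%:Z) = ('X^k * chain a b.+2 ord0 ord0)`_r.
Proof.
move=> ab; rewrite coefXnM; case: ltnP => rk.
  by have -> : r%:Z - k%:Z = Negz (k - r).-1 by lia.
by rewrite subzn // Psi_coef.
Qed.

End Continuant.

(** * The integrals as coefficients of a trace *)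

Section Chain.
Variables (R : comNzRingType) (c : nat -> R).

Lemma chain10 (a b : nat) : (a < b)%N ->
  chain c a b ord_max ord0 = chain c a.+1 b ord0 ord0.
Proof.
by move=> ab; rewrite /chain big_ltn // mulmx2E !mxE /= mul1r mul0r addr0.
Qed.

Lemma chain_right (a b : nat) i : (a <= b)%N ->
  chain c a b.+1 i ord_max = 'X * chain c a b i ord0.
Proof.
by move=> ab; rewrite /chain big_nat_recr // mulmx2E !mxE /= mulr0 addr0 mulrC.
Qed.

End Chain.

Section CyclicVariables.
Variables (R : comNzRingType) (n : nat).

(* Extended to all k with period 2n+1. *)
Definition xvar (u : 'rV[R]_(2 * n)) (k : nat) : R :=
  let j := (k %% (2 * n).+1)%N in
  if (j < (2 * n).-1)%N then cvar u j.+1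
  else if j == (2 * n).-1 then - U1 u else - U2 u.

Definition zvar (gamma : R) (k : nat) : {poly R} :=
  'X - (if (k %% (2 * n).+1)%N == (2 * n).-1 then gamma else 0)%:P.

Definition Lvar gamma (u : 'rV[R]_(2 * n)) k : 'M[{poly R}]_2 :=
  Lax (xvar u k)%:P (zvar gamma k).

Lemma xvar_per u k : xvar u (k + (2 * n).+1) = xvar u k.
Proof. by rewrite /xvar modnDr. Qed.

Lemma zvar_per gamma k : zvar gamma (k + (2 * n).+1) = zvar gamma k.
Proof. by rewrite /zvar modnDr. Qed.

(** The last two Lax matrices multiply to [[U_1 U_2 - gamma + X, -U_1 X], [-U_2, X]]. Pairing these
    entries with those of the chain of the c_i gives the five terms of [I_]. *)
Lemma I_coef gamma r u : (0 < n)%N -> (r <= n - 1)%N ->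
  I_ gamma r u = (\tr (\prod_(0 <= k < (2 * n).+1) Lvar gamma u k))`_r.
Proof.
move=> n0 rn; have N1 : (2 * n = (2 * n).-1.+1)%N by lia.
have -> : \prod_(0 <= k < (2 * n).+1) Lvar gamma u k =
    chain (cvar u) 1 (2 * n) *
    (Lax (- U1 u)%:P ('X - gamma%:P) * Lax (- U2 u)%:P 'X).
  rewrite big_nat_recr //= [X in \prod_(0 <= k < X) _]N1 big_nat_recr //=.
  rewrite -mulrA; congr (_ * (_ * _)).
  - rewrite /chain big_add1 big_nat_cond [RHS]big_nat_cond.
    apply: eq_big => [k|k /andP[/andP[_ kn] _]]; first by lia.
    rewrite /Lvar /xvar /zvar modn_small; last by lia.
    by rewrite kn ltn_eqF // subr0.
  - rewrite /Lvar /xvar /zvar modn_small; last by lia.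
    by rewrite ltnn eqxx.
  - rewrite /Lvar /xvar /zvar modn_small; last by lia.
    by rewrite ltnNge leq_pred /= gtn_eqF ?subr0 //; lia.
have -> : I_ gamma r u = ('X * chain (cvar u) 1 (2 * n) ord0 ord0
    - (U2 u)%:P * ('X * chain (cvar u) 1 (2 * n).-1 ord0 ord0)
    - (U1 u)%:P * ('X * chain (cvar u) 2 (2 * n) ord0 ord0)
    + 'X * ('X * chain (cvar u) 1 (2 * n).-1 ord_max ord0)
    + (U1 u * U2 u - gamma)%:P * chain (cvar u) 1 (2 * n) ord0 ord0)`_r.
  have Ne : (2 * n - 2).+2 = (2 * n)%N by lia.
  have PB a b k : (a <= b.+2)%N -> Psi (cvar u) a b (r%:Z - k%:Z) =
      ('X^k * chain (cvar u) a b.+2 ord0 ord0)`_r by exact: Psi_coefB.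
  rewrite !(coefD, coefN, coefCM) /I_ -[r%:Z in X in _ + X]subr0.
  rewrite (PB _ _ 0%N) 1?(PB _ _ 2%N) ?(PB _ _ 1%N); [|lia..].
  rewrite Ne expr0 expr1 mul1r.
  (* For n = 1 only r = 0 occurs, which hides the truncation in 2 * n - 3. *)
  case: r rn {PB} => [|r] rn.
    by rewrite expr2 -!mulrA !coefXM /= !mulr0 subr0 addr0.
  have -> : (2 * n - 3).+2 = (2 * n).-1 by lia.
  by rewrite chain10 ?expr2 ?mulrA //; lia.
have chr i : chain (cvar u) 1 (2 * n) i ord_max =
    'X * chain (cvar u) 1 (2 * n).-1 i ord0.
  by rewrite [X in chain _ _ X _ ord_max]N1 chain_right //; lia.
rewrite mxtrace2E !mulmx2E !mxE /= !chr (chain10 _ (b := (2 * n)%N)); last lia.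
apply: (congr1 (fun p : {poly R} => p`_r)).
by rewrite !(polyCB, polyCM, polyCN); ring.
Qed.

End CyclicVariables.

(** * Derivatives of the integrals *)

Section CoefDerive.
Variables (R : realType) (V : normedModType R) (u v : V).

Lemma is_derive_linear (f : V -> R) :
  (forall a w w', f (a *: w + w') = a * f w + f w') -> is_derive u v f (f v).
Proof.
move=> f_lin.
have cv : ((fun h : R => h^-1 *: ((f \o shift u) (h *: v) - f u)) @ 0^' --> f v)%classic.
  apply: cvg_near_cst; near=> h.
  rewrite /= f_lin addrK /GRing.scale /= mulKf //.
  by near: h; exact: nbhs_dnbhs_neq.
by apply: DeriveDef; [apply: cvgP cv|apply: cvg_lim cv].
Unshelve. all: by end_near. Qed.

(** Working coefficientwise means that only real-valued functions are differentiated. *)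
Definition coef_derive (P : V -> {poly R}) (dP : {poly R}) :=
  forall r, is_derive u v (fun w => (P w)`_r) dP`_r.

Lemma coef_derive_cst (p : {poly R}) : coef_derive (fun=> p) 0.
Proof. by move=> r; rewrite coef0; exact: is_derive_cst. Qed.

Lemma coef_deriveD P Q dP dQ : coef_derive P dP -> coef_derive Q dQ ->
  coef_derive (fun w => P w + Q w) (dP + dQ).
Proof.
move=> hP hQ r; rewrite coefD.
under eq_fun do rewrite coefD.
exact: is_deriveD.
Qed.

Lemma coef_deriveM P Q dP dQ : coef_derive P dP -> coef_derive Q dQ ->
  coef_derive (fun w => P w * Q w) (dP * Q u + P u * dQ).
Proof.
move=> hP hQ r; rewrite coefD !coefM -big_split /=.
have -> : (fun w => (P w * Q w)`_r) =
    \sum_(j < r.+1) ((fun w => (P w)`_j) * (fun w => (Q w)`_(r - j))).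
  by apply/funext => w; rewrite coefM fct_sumE.
apply: is_derive_sum => j.
apply: is_derive_eq (is_deriveM (hP j) (hQ (r - j)%N)) _.
by rewrite /GRing.scale /=; ring.
Qed.

Lemma coef_derive_const (f : V -> R) df : is_derive u v f df ->
  coef_derive (fun w => (f w)%:P) df%:P.
Proof.
move=> hf r; rewrite coefC.
under eq_fun do rewrite coefC.
by case: eqP => _ //; exact: is_derive_cst.
Qed.

Definition mx_derive (M : V -> 'M[{poly R}]_2) (dM : 'M[{poly R}]_2) :=
  forall i j, coef_derive (fun w => M w i j) (dM i j).

Lemma mx_derive_cst (M : 'M[{poly R}]_2) : mx_derive (fun=> M) 0.
Proof. by move=> i j; rewrite mxE; exact: coef_derive_cst. Qed.

Lemma mx_deriveM M N dM dN : mx_derive M dM -> mx_derive N dN ->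
  mx_derive (fun w => M w * N w) (dM * N u + M u * dN).
Proof.
move=> hM hN i j; rewrite mxE !mulmx2E addrACA.
under eq_fun do rewrite mulmx2E.
by apply: coef_deriveD; apply: coef_deriveM.
Qed.

Lemma mx_derive_prod (L : nat -> V -> 'M[{poly R}]_2) dL m :
  (forall k, mx_derive (L k) (dL k)) ->
  mx_derive (fun w => \prod_(0 <= k < m) L k w)
    (\sum_(0 <= k < m) \prod_(0 <= i < k) L i u * dL k *
                       \prod_(k.+1 <= i < m) L i u).
Proof.
move=> hL; elim: m => [|m IHm].
  under eq_fun do rewrite big_geq //.
  by rewrite big_geq //; exact: mx_derive_cst.
under eq_fun do rewrite big_nat_recr //=.
rewrite big_nat_recr //= [\prod_(m.+1 <= i < m.+1) _]big_geq // mulr1.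
have -> : \sum_(0 <= k < m) \prod_(0 <= i < k) L i u * dL k *
                       \prod_(k.+1 <= i < m.+1) L i u =
  (\sum_(0 <= k < m) \prod_(0 <= i < k) L i u * dL k *
                       \prod_(k.+1 <= i < m) L i u) * L m u.
  rewrite mulr_suml; apply: eq_big_nat => k /andP[_ km].
  by rewrite [in LHS]big_nat_recr //= !mulrA.
exact: mx_deriveM.
Qed.

(** Subtracting [Lax 0 0] removes the constant entry 1, leaving [df] alone in the upper left
    corner. *)
Lemma mx_derive_Lax (f : V -> R) df (z : {poly R}) : is_derive u v f df ->
  mx_derive (fun w => Lax (f w)%:P z) (Lax df%:P 0 - Lax 0 0).
Proof.
move=> hf i j; rewrite !mxE.
under eq_fun do rewrite mxE.
case: eqP => _; last by rewrite subrr; exact: coef_derive_cst.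
case: eqP => _; last by rewrite subrr; exact: coef_derive_cst.
by rewrite subr0; exact: coef_derive_const.
Qed.

End CoefDerive.

Section DeriveI.
Variables (R : realType) (n : nat) (gamma : R).
Implicit Types u v w : 'rV[R]_(2 * n).

Lemma coord1_linear a v w i :
  coord1 (a *: v + w) i = a * coord1 v i + coord1 w i.
Proof.
rewrite /coord1 mulr_sumr -big_split /=; apply: eq_bigr => j _.
by rewrite !mxE.
Qed.

Lemma xvar_linear a v w k : xvar (a *: v + w) k = a * xvar v k + xvar w k.
Proof.
rewrite /xvar; case: ifP => _; last case: ifP => _.
- by rewrite /cvar !coord1_linear; ring.
- rewrite mulrN -opprD /U1 mulr_sumr -big_split; congr (- _).
  by apply: eq_bigr => i _; rewrite coord1_linear.
- rewrite mulrN -opprD /U2 mulr_sumr -big_split; congr (- _).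
  by apply: eq_bigr => i _; rewrite coord1_linear.
Qed.

Definition gradx u k := mono_grad (2 * n) (fun k => (xvar u k)%:P) (zvar n gamma) k.

Lemma is_derive_I r u v : (0 < n)%N -> (r <= n - 1)%N ->
  is_derive u v (I_ gamma r)
    (\sum_(0 <= k < (2 * n).+1) (gradx u k)`_r * xvar v k).
Proof.
move=> n0 rn; rewrite (_ : I_ gamma r = fun w =>
    (\tr (\prod_(0 <= k < (2 * n).+1) Lvar gamma w k))`_r); last first.
  by apply/funext => w; exact: I_coef.
pose dL k : 'M[{poly R}]_2 := Lax (xvar v k)%:P 0 - Lax 0 0.
have hL k : mx_derive u v (Lvar gamma ^~ k) (dL k).
  by apply/mx_derive_Lax/is_derive_linear => *; exact: xvar_linear.
have := mx_derive_prod (2 * n).+1 hL; set dT := \sum_(_ <= _ < _) _ => hT.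
under eq_fun do rewrite mxtrace2E.
apply: is_derive_eq (coef_deriveD (hT ord0 ord0) (hT ord_max ord_max) r) _.
rewrite -mxtrace2E /dT raddf_sum coef_sum; apply: eq_big_nat => k /andP[_ km] /=.
rewrite -mulmxE mxtrace_mulC mulmxA mulmxE.
(* Under the trace the prefix now follows the suffix. Shifted by one period, it extends the suffix
   to the cofactor of [k]. *)
have <- : \prod_((2 * n).+1 <= i < k + (2 * n).+1) Lvar gamma u i =
    \prod_(0 <= i < k) Lvar gamma u i.
  rewrite -[X in \prod_(X <= _ < _) _]add0n; apply: prod_Lax_shift => j.
    by rewrite xvar_per.
  exact: zvar_per.
rewrite -big_cat_nat //=; last by rewrite leq_addl.
rewrite mxtrace2E !mulmx2E !mxE /= !subrr subr0 !mulr0 !addr0.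
by rewrite coefMC.
Qed.

End DeriveI.

(** * The Poisson bracket *)

Section Bracket.
Variable R : comNzRingType.

Definition omega (i j : nat) : R :=
  if (i < j)%N then (if odd (i + j) then 1 else -1)
  else if (j < i)%N then (if odd (i + j) then -1 else 1) else 0.

Lemma OmegaE m (i j : 'I_m) : Omega R m i j = omega i j.
Proof.
rewrite mxE /omega -[_ ^+ (j - i + 1)]signr_odd -[_ ^+ (i - j + 1)]signr_odd.
rewrite !addn1 /=.
case: (ltngtP i j) => // ij; rewrite oddB 1?ltnW // oddD.
  by case: (odd i); case: (odd j); rewrite /= ?expr0 ?expr1.
by case: (odd i); case: (odd j); rewrite /= ?expr0 ?expr1 ?opprK.
Qed.

(** Consecutive rows of [Omega] are opposite away from the diagonal, which makes the brackets of the
    sums c_i local. *)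
Lemma omega_step i j : omega i j + omega i.+1 j = (j == i.+1)%:R - (j == i)%:R.
Proof.
rewrite /omega addSn oddS.
have [ij|ij|<-] := ltngtP i.+1 j.
- rewrite (_ : (j == i) = false); last lia.
  by case: odd; rewrite /= ?subrr ?addNr.
- rewrite ltnS in ij.
  have [ji|ji|->] := ltngtP j i; [|lia|].
  + by case: odd; rewrite /= ?subrr ?addNr.
  + by rewrite addnn odd_double.
- rewrite addnS oddS addnn odd_double (_ : (i.+1 == i) = false) //=; last lia.
  by rewrite addr0 subr0.
Qed.

(** Signs alternate down a column except around the diagonal. The cases p = 2n - 1 and p = 2n serve
    for U_1 and U_2. *)
Lemma omega_sum p j : \sum_(0 <= i < p) omega i j =
  if (p <= j)%N then (odd p)%:R * (if odd j then 1 else -1)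
  else (odd j)%:R - (odd (p + j).+1)%:R.
Proof.
elim: p => [|p IHp]; first by rewrite big_geq // mul0r.
rewrite big_nat_recr //= IHp /omega !oddD /= !oddD.
have [pj|pj|->] := ltngtP p j.
- by case: (odd p); case: (odd j) => /=; ring.
- by case: (odd p); case: (odd j) => /=; ring.
- by case: (odd j) => /=; ring.
Qed.

Lemma coord1E m (u : 'rV[R]_m) (i : 'I_m) : coord1 u i.+1 = u ord0 i.
Proof. by rewrite /coord1 (big_pred1 i) // => j; rewrite eqSS. Qed.

Lemma coord1_delta m (j : 'I_m) i :
  coord1 (delta_mx ord0 j : 'rV[R]_m) i = (i == j.+1)%:R.
Proof.
rewrite /coord1; have [->|ij] := eqVneq i j.+1.
  by rewrite (big_pred1 j) ?mxE ?eqxx // => k; rewrite eqSS.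
rewrite big1 // => k /eqP ki; rewrite mxE /=.
by case: eqP => // kj; rewrite -ki kj eqxx in ij.
Qed.

Lemma sum_eq_nat (F : nat -> R) a b j :
  \sum_(a <= i < b) F i * (i == j)%:R = if (a <= j < b)%N then F j else 0.
Proof.
case: ifP => jab.
  rewrite (bigD1_seq j) ?mem_index_iota ?iota_uniq //= eqxx mulr1.
  by rewrite big1 ?addr0 // => i /negPf->; rewrite mulr0.
rewrite big_nat big1 // => i iab; case: eqP => [ij|_]; last by rewrite mulr0.
by rewrite -ij iab in jab.
Qed.

Variables (n : nat) (b : nat -> R).
Hypotheses (n0 : (0 < n)%N) (b_per : forall k, b (k + (2 * n).+1) = b k).

(* The derivative with respect to u_{j+1} of a function of x_0, ..., x_{2n} with
   partial derivatives b_0, ..., b_{2n}; j + 2n stands for the index j - 1. *)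
Definition gradu j := b (j + 2 * n) + b j - b (2 * n).-1 - b (2 * n).

(** The variable u_{j+1} occurs in c_j, c_{j+1}, U_1 and U_2. At the two ends one c and one U are
    missing, and the corresponding terms of [gradu] cancel each other. *)
Lemma sum_xvar_delta (j : 'I_(2 * n)) :
  \sum_(0 <= k < (2 * n).+1) b k * xvar (delta_mx ord0 j) k = gradu j.
Proof.
have N1 : (2 * n = (2 * n).-1.+1)%N by lia.
have lt_j := ltn_ord j.
rewrite big_nat_recr //= [X in \sum_(0 <= k < X) _]N1 big_nat_recr //=.
rewrite /xvar !modn_small ?ltnn ?eqxx; [|lia..].
rewrite ltnNge leq_pred /= gtn_eqF; last lia.
have -> : U1 (delta_mx ord0 j : 'rV[R]__) = (j.+1 < 2 * n)%:R.
  rewrite /U1; under eq_bigr do rewrite coord1_delta -[_%:R]mul1r.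
  by rewrite (sum_eq_nat (fun=> 1)) /=; case: (_ < _)%N.
have -> : U2 (delta_mx ord0 j : 'rV[R]__) = (0 < j)%:R.
  rewrite /U2; under eq_bigr do rewrite coord1_delta -[_%:R]mul1r.
  by rewrite (sum_eq_nat (fun=> 1)) !ltnS lt_j andbT; case: (_ < _)%N.
have -> : \sum_(0 <= k < (2 * n).-1) b k *
    (let i := (k %% (2 * n).+1)%N in
     if (i < (2 * n).-1)%N then cvar (delta_mx ord0 j : 'rV[R]_(2 * n)) i.+1
     else if i == (2 * n).-1 then - (j.+1 < 2 * n)%:R else - (0 < j)%:R) =
  (j < (2 * n).-1)%:R * b j + (0 < j)%:R * b j.-1.
  transitivity (\sum_(0 <= k < (2 * n).-1) b k * (k == j)%:R +
                (0 < j)%:R * \sum_(0 <= k < (2 * n).-1) b k * (k == j.-1)%:R).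
    rewrite mulr_sumr -big_split; apply: eq_big_nat => k /andP[_ kn] /=.
    rewrite modn_small; last lia.
    rewrite kn /cvar !coord1_delta !eqSS mulrDr; congr (_ + _).
    case: (nat_of_ord j) => [|i] /=; first by rewrite mul0r mulr0.
    by rewrite eqSS mul1r.
  rewrite !sum_eq_nat /=.
  congr (_ + _); first by case: (_ < _)%N; rewrite /= ?mul1r ?mul0r.
  case: ifP => // h; rewrite (_ : (0 < j)%N = false) ?mul0r //; lia.
rewrite /gradu; have [j0|j0] := posnP j.
  have [h0 h1] : (0 < (2 * n).-1)%N /\ (1 < 2 * n)%N by lia.
  by rewrite j0 add0n h0 h1 /=; ring.
have -> : (j + 2 * n = j.-1 + (2 * n).+1)%N by lia.
rewrite b_per; have [jn|jn] := ltnP j (2 * n).-1.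
  have -> : (j.+1 < 2 * n)%N by lia.
  by rewrite /=; ring.
have -> : nat_of_ord j = (2 * n).-1 by lia.
by rewrite -N1 ltnn /=; ring.
Qed.

(* The Hamiltonian vector field of such a function: [xvar_hamvec] says that
   {x_k, .} = d/dx_{k+1} - d/dx_{k-1}. *)
Definition hamvec : 'rV[R]_(2 * n) :=
  \row_i \sum_(0 <= j < 2 * n) omega i j * gradu j.

Lemma xvar_hamvec k : (k < (2 * n).+1)%N ->
  xvar hamvec k = b k.+1 - b (k + 2 * n)%N.
Proof.
pose s i := \sum_(0 <= j < 2 * n) omega i j * gradu j.
have cS i : (i < 2 * n)%N -> coord1 hamvec i.+1 = s i.
  by move=> ilt; rewrite -[i]/(nat_of_ord (Ordinal ilt)) coord1E mxE.
have sum_s p : \sum_(0 <= i < p) s i =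
    \sum_(0 <= j < 2 * n) (\sum_(0 <= i < p) omega i j) * gradu j.
  rewrite exchange_big; apply: eq_bigr => j _; exact/esym/mulr_suml.
have gradu_sum p : (p < 2 * n)%N ->
    gradu p = \sum_(0 <= j < 2 * n) gradu j * (j == p)%:R.
  by move=> pn; rewrite sum_eq_nat ifT.
have sE : (2 * n = (2 * n).-1.+1)%N by lia.
move=> kn; rewrite /xvar modn_small //; case: ltnP => [kn1|nk].
  (* By [omega_step] the sum collapses to [gradu k.+1 - gradu k]. *)
  rewrite /cvar !cS; [|lia..].
  rewrite /s -big_split.
  under eq_bigr => j _.
    rewrite /= -mulrDl omega_step mulrBl mulrC [X in _ - X]mulrC.
    over.
  rewrite sumrB !sum_eq_nat !ifT; [|lia..].
  by rewrite /gradu addSn -addnS b_per; ring.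
case: eqP => [->|/eqP kn1].
  (* Over the first 2n - 1 rows, all column sums of [Omega] vanish except the last, which is 1. *)
  have -> : U1 hamvec = gradu (2 * n).-1.
    rewrite /U1 big_add1.
    transitivity (\sum_(0 <= i < (2 * n).-1) s i).
      by apply: eq_big_nat => i /andP[_ ilt]; rewrite cS //; lia.
    rewrite sum_s [RHS]gradu_sum; last lia.
    apply: eq_big_nat => j /andP[_ jn].
    rewrite omega_sum mulrC; congr (_ * _).
    have odd1 : odd (2 * n).-1 = true by rewrite -[odd _]negbK -oddS -sE oddM.
    case: leqP => pj.
      have -> : j = (2 * n).-1 by lia.
      by rewrite odd1 eqxx mulr1.
    by rewrite oddS oddD odd1 negbK subrr ltn_eqF.
  by rewrite /gradu -sE addnC; ring.
(* Each full column sum of [Omega] equals the entry in row 0, except in column 0, where it is -1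
   instead of 0. *)
have -> : U2 hamvec = - gradu 0.
  rewrite /U2 big_add1 /=.
  transitivity (\sum_(0 <= i < 2 * n) s i - s 0).
    rewrite [X in _ = X - _]big_ltn; last lia.
    rewrite [RHS]addrC addKr.
    by apply: eq_big_nat => i /andP[_ ilt]; rewrite cS.
  rewrite sum_s /s -sumrB [in RHS]gradu_sum; last lia.
  rewrite -sumrN; apply: eq_big_nat => j /andP[_ jn].
  rewrite -mulrBl omega_sum mulrC -mulrN; congr (_ * _).
  rewrite /omega add0n oddS oddD oddM /=.
  rewrite ifF; last lia.
  by case: j {jn} => [|j] /=; [ring|case: odd => /=; ring].
have -> : k = (2 * n)%N by lia.
have -> : (2 * n + 2 * n = (2 * n).-1 + (2 * n).+1)%N by lia.
by rewrite b_per (b_per 0) /gradu add0n; ring.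
Qed.

End Bracket.

(** * Involution of the integrals *)

Section Involution.
Variables (R : realType) (n : nat) (gamma : R) (u : 'rV[R]_(2 * n)).

Lemma gradx_per k : gradx gamma u (k + (2 * n).+1) = gradx gamma u k.
Proof. by apply: mono_grad_per => j; rewrite ?xvar_per ?zvar_per. Qed.

Lemma gradx_involution r s :
  \sum_(0 <= k < (2 * n).+1)
    ((gradx gamma u k)`_r * (gradx gamma u k.+1)`_s -
     (gradx gamma u k.+1)`_r * (gradx gamma u k)`_s) = 0.
Proof.
pose X k : {poly R} := (xvar u k)%:P.
pose Z := zvar n gamma.
have Xper k : X (k + (2 * n).+1)%N = X k by rewrite /X xvar_per.
have Zper k : Z (k + (2 * n).+1)%N = Z k by rewrite /Z zvar_per.
pose E := mono_edge (2 * n) X Z.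
(* Two independent parameters: [lam] uses the outer variable of [{poly {poly R}}], [mu] the inner
   one. They agree on constants, hence on the [X k]. *)
pose lam : {poly R} -> {poly {poly R}} := map_poly polyC.
pose mu : {poly R} -> {poly {poly R}} := polyC.
have XE k : lam (X k) = mu (X k) by rewrite /lam /mu /X map_polyC.
have := @cyclic_involution _ (2 * n).+1 (lam \o X) (lam \o Z) (mu \o Z)
  (lam \o gradx gamma u) (mu \o gradx gamma u) (lam \o E) (mu \o E)
  (lam (\tr (\prod_(0 <= k < 0 + (2 * n).+1) Lax (X k) (Z k))))
  (mu (\tr (\prod_(0 <= k < 0 + (2 * n).+1) Lax (X k) (Z k)))) ('X - 'X%:P).
move=> inv; have {inv} : \sum_(0 <= k < (2 * n).+1)
   (lam (gradx gamma u k) * mu (gradx gamma u k.+1) -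
    lam (gradx gamma u k.+1) * mu (gradx gamma u k)) = 0.
  apply: inv => [|k|||||k|k|k|k|k|k] /=.
  - by rewrite polyXsubC_eq0.
  (* The shift by [gamma] cancels, so the difference is the same for every [k]. *)
  - rewrite /lam /mu /Z /zvar rmorphB /= map_polyX map_polyC /= polyCB.
    by rewrite opprB addrA subrK.
  - by rewrite -[RHS](congr1 lam (Zper 0%N)).
  - by rewrite -[RHS](congr1 mu (Zper 0%N)).
  - by rewrite -[RHS](congr1 lam (mono_edge_per Xper Zper 0%N)).
  - by rewrite -[RHS](congr1 mu (mono_edge_per Xper Zper 0%N)).
  - by rewrite gradx_per.
  - by rewrite gradx_per.
  - by rewrite -!rmorphM -!rmorphB -rmorphM (mono_neighbours Xper Zper).
  - by rewrite XE -!rmorphM -!rmorphB -rmorphM (mono_neighbours Xper Zper).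
  - by rewrite -(mono_expand Xper Zper k) /lam !rmorphD rmorphM.
  - by rewrite XE -(mono_expand Xper Zper k) /mu !rmorphD rmorphM.
move=> /(congr1 (fun P : {poly {poly R}} => P`_r`_s)).
rewrite !coef0 !coef_sum => E0; rewrite -[RHS]E0; apply: eq_bigr => k _.
by rewrite !coefB /lam /mu !coefMC !coef_map /= !coefCM.
Qed.

End Involution.

Theorem theorem14 (R : realType) (n : nat) (hn : (1 <= n)%N) (gamma : R)
    (r s : nat) (hr : (r <= n - 1)%N) (hs : (s <= n - 1)%N)
    (u : 'rV[R]_(2 * n)) :
  poisson (I_ gamma r) (I_ gamma s) u = 0.
Proof.
have gradE q : (q <= n - 1)%N -> forall j,
    gradient (I_ gamma q) u ord0 j =
    \sum_(0 <= k < (2 * n).+1) (gradx gamma u k)`_q * xvar (delta_mx ord0 j) k.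
  move=> hq j; rewrite mxE; apply: derive_val; exact: is_derive_I.
pose a k := (gradx gamma u k)`_r; pose b k := (gradx gamma u k)`_s.
have a_per k : a (k + (2 * n).+1)%N = a k by rewrite /a gradx_per.
have b_per k : b (k + (2 * n).+1)%N = b k by rewrite /b gradx_per.
(* The bracket is the derivative of I_r along the Hamiltonian vector field of I_s. *)
have -> : poisson (I_ gamma r) (I_ gamma s) u =
    \sum_j gradient (I_ gamma r) u ord0 j * hamvec n b ord0 j.
  rewrite /poisson -mulmxA mxE; apply: eq_bigr => j _; congr (_ * _).
  rewrite !mxE big_mkord; apply: eq_bigr => i _.
  by rewrite OmegaE [X in _ * X]mxE gradE // sum_xvar_delta.
have xvar_sum (w : 'rV[R]_(2 * n)) k :
    xvar w k = \sum_j w ord0 j * xvar (delta_mx ord0 j) k.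
  have x0 : xvar (0 : 'rV[R]_(2 * n)) k = 0.
    have := xvar_linear (-1) 0 (0 : 'rV[R]_(2 * n)) k.
    by rewrite scaler0 addr0 mulN1r addNr.
  rewrite {1}(row_sum_delta w); elim/big_rec2: _ => // j x y _ <-.
  exact: xvar_linear.
transitivity (\sum_(0 <= k < (2 * n).+1) a k * xvar (hamvec n b) k).
  under eq_bigr do rewrite gradE // mulr_suml.
  rewrite exchange_big; apply: eq_bigr => k _ /=.
  rewrite xvar_sum mulr_sumr; apply: eq_bigr => j _.
  by rewrite -mulrA [xvar _ _ * _]mulrC.
transitivity (\sum_(0 <= k < (2 * n).+1) (a k * b k.+1 - a k.+1 * b k)); last first.
  exact: gradx_involution.
rewrite sumrB.
transitivity (\sum_(0 <= k < (2 * n).+1) (a k * b k.+1 - a k * b (k + 2 * n)%N)).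
  by apply: eq_big_nat => k /andP[_ kn]; rewrite xvar_hamvec // mulrBr.
rewrite sumrB; congr (_ - _).
(* A cyclic shift of the summation index: [b (k + 2 * n)] is b_{k-1}, and the term k = 0 becomes the
   last one. *)
rewrite big_nat_recl // [RHS]big_nat_recr //= addrC; congr (_ + _).
  by rewrite -(a_per 0%N).
by apply: eq_bigr => k _; rewrite addSn -addnS b_per.
Qed.
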